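(* For every integer $n\ge 2$, $$\lim_{H\to\infty}\frac{D_n(H)}{(2H)^n}=1,$$ where, for a positive integer $H$, $D_n(H)$ denotes the number of dominant monic polynomials $f(X)=X^n+a_1X^{n-1}+\cdots+a_n\in\mathbb{Z}[X]$ with $|a_i|\le H$ for $i=1,\ldots,n$.
   Context: A polynomial $f\in\mathbb{C}[X]$ of degree $n\ge 2$ with roots $\alpha_1,\ldots,\alpha_n\in\mathbb{C}$ (listed with multiplicity) is called dominant if there is an index $i$ such that $|\alpha_i|>|\alpha_j|$ for all $j\ne i$; equivalently, $f$ has a simple root whose modulus is strictly greater than the moduli of all its remaining roots. $H$ runs through positive integers. *)

(* Defs.v *)
From HB Require Import structures.
From mathcomp Require Import all_boot all_order all_algebra.
From mathcomp Require Import complex.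
From mathcomp Require Import finmap.
From mathcomp Require Import all_classical all_reals all_analysis.
Set Implicit Arguments.
Unset Strict Implicit.
Unset Printing Implicit Defensive.
Import Order.TTheory GRing.Theory Num.Theory.
Import numFieldNormedType.Exports.
Local Open Scope classical_set_scope.
Local Open Scope ring_scope.

(* [alpha] lists the roots of [f] with multiplicity; [(size f).-1] is the
   degree of [f], and the zero polynomial (no index [i]) is not dominant. *)
Definition dominant (C : numClosedFieldType) (f : {poly C}) : Prop :=
  exists alpha : 'I_(size f).-1 -> C,
    f = lead_coef f *: \prod_i ('X - (alpha i)%:P) /\
    exists i, forall j, j != i -> `|alpha j| < `|alpha i|.

Definition monic_box (n H : nat) : set {poly int} :=
  [set f | f \is monic /\ size f = n.+1 /\
           forall k, (k < n)%N -> `|f`_k| <= H%:Z].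

Definition dominant_monic (R : realType) (n H : nat) : set {poly int} :=
  [set f | monic_box n H f /\
           dominant (map_poly (intr : int -> R[i]) f)].

Lemma finite_monic_box n H : finite_set (monic_box n H).
Proof.
pose g (a : {ffun 'I_n.+1 -> 'I_(H.+1).*2.+1}) : {poly int} :=
  \poly_(k < n.+1) ((a (inord k))%:Z - H.+1%:Z).
apply: (@sub_finite_set _ _ (range g)); last exact: finite_image.
move=> f [/monicP lf [sf bf]].
have bd k : (k < n.+1)%N -> `|f`_k| <= H.+1%:Z.
  rewrite ltnS leq_eqVlt => /orP[/eqP ->|/bf h].
    by move: lf; rewrite lead_coefE sf /= => ->.
  by apply: le_trans h _; rewrite lez_nat.
exists [ffun k : 'I_n.+1 => inord (absz (f`_k + H.+1%:Z))] => //.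
apply/polyP => k; rewrite coef_poly; case: ltnP => kn; last first.
  by rewrite nth_default // sf.
have := bd _ kn; rewrite ler_norml => /andP[lo hi].
have p0 : 0 <= f`_k + H.+1%:Z by rewrite -lerBlDr sub0r.
rewrite /= ffunE !inordK // ?gez0_abs ?addrK //.
by rewrite ltnS -lez_nat gez0_abs // -addnn PoszD lerD2r.
Qed.

Lemma finite_dominant_monic (R : realType) n H :
  finite_set (dominant_monic R n H).
Proof. by apply: sub_finite_set (finite_monic_box n H) => f []. Qed.

(* By [finite_dominant_monic], [fset_set] does not take its default value. *)
Definition D (R : realType) (n H : nat) : nat :=
  #|` fset_set (dominant_monic R n H)|.

(* Main.v *)
(** If [H / k <= |a_1|], some root [a] satisfies [|a| >= H / (k n)], since
    [- a_1] is the sum of the [n] roots.  Dividing by [X - a] and comparing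
    coefficients from the constant term up, every coefficient of the cofactor
    has modulus at most [2 k n], so by Cauchy's bound all other roots have
    modulus at most [1 + 2 k n], which is less than [|a|] for large [H].
    Thus at least [(2H)^(n-1) * 2(H - H %/ k)] of the at most [(2H+1)^n]
    polynomials are dominant, and [k] is arbitrary. *)
Require Import Defs.
From HB Require Import structures.
From mathcomp Require Import all_boot all_order all_algebra.
From mathcomp Require Import complex.
From mathcomp Require Import finmap.
From mathcomp Require Import zify.
From mathcomp Require Import all_classical all_reals all_analysis.
Set Implicit Arguments.
Unset Strict Implicit.
Unset Printing Implicit Defensive.
Import Order.TTheory GRing.Theory Num.Theory.
Import numFieldNormedType.Exports.
Local Open Scope classical_set_scope.
Local Open Scope ring_scope.

(** * Root bounds and a criterion for dominance *)

(** If [|x| > 1 + B], then [g(x) = 0] gives [|x|^m <= B (1 + ... + |x|^(m-1))]; multiplying by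
    [|x| - 1] yields [B |x|^m < B (|x|^m - 1)], which forces [B < 0]. *)
Lemma Cauchy_bound_monic (C : numDomainType) (g : {poly C}) (m : nat)
    (B x : C) :
  g \is monic -> size g = m.+1 -> 0 <= B ->
  (forall k, (k < m)%N -> `|g`_k| <= B) -> root g x -> `|x| <= 1 + B.
Proof.
move=> gm sg B0 gB /rootP gx.
have rB : 1 + B \is Num.real by rewrite rpredD ?rpred1 // ger0_real.
rewrite real_leNgt ?normr_real //; apply/negP => ltx.
have x1 : 0 < `|x| - 1 by rewrite subr_gt0 (le_lt_trans _ ltx) // lerDl.
have xm_le : `|x| ^+ m <= B * \sum_(i < m) `|x| ^+ i.
  move: gx; rewrite horner_coef sg big_ord_recr /=.
  have -> : g`_m = 1 by move/monicP: gm; rewrite lead_coefE sg.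
  rewrite mul1r addrC => /eqP; rewrite addr_eq0 => /eqP xm.
  rewrite -normrX xm normrN mulr_sumr (le_trans (ler_norm_sum _ _ _)) //.
  by apply: ler_sum => i _; rewrite normrM normrX ler_wpM2r ?exprn_ge0 ?gB.
have := ler_wpM2l (ltW x1) xm_le.
rewrite mulrCA -subrX1 => le1.
have : B * `|x| ^+ m < (`|x| - 1) * `|x| ^+ m.
  rewrite ltr_pM2r ?ltrBrDl // exprn_gt0 //.
  by rewrite (lt_trans ltr01) // -subr_gt0.
move=> /lt_le_trans /(_ le1); rewrite mulrBr mulr1 -subr_gt0 addrAC subrr sub0r.
by rewrite oppr_gt0 => /lt_geF; rewrite B0.
Qed.

(* Comparing coefficients from the bottom up, [a g_k = g_(k-1) - f_k]. *)
Lemma coef_cofactor_XsubC_bound (C : numDomainType) (g : {poly C}) (a K : C)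
    (n : nat) :
  0 <= K -> 2 <= `|a| ->
  (forall k, (k < n)%N -> `|(('X - a%:P) * g)`_k| <= K * `|a|) ->
  forall k, (k < n)%N -> `|g`_k| <= 2 * K.
Proof.
move=> K0 a2 fK; have a0 : 0 < `|a| by rewrite (lt_le_trans _ a2) // ltr0n.
elim=> [|k IHk] kn; have := fK _ kn; rewrite mulrBl coefB coefXM coefCM /=.
  rewrite sub0r normrN normrM mulrC ler_pM2r // => /le_trans; apply.
  by rewrite mulr_natl mulr2n lerDl.
move=> fk; rewrite -(ler_pM2r a0) -mulrA.
have -> : `|g`_k.+1| * `|a| = `|g`_k - (g`_k - a * g`_k.+1)|.
  by rewrite opprB addrC subrK normrM mulrC.
(* Since [2 <= |a|], the inductive bound [2 K] on [g_k] is at most [K |a|], so the constant does not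
   grow with [k]. *)
rewrite (le_trans (ler_normB _ _)) // mulr_natl mulr2n lerD //.
by rewrite (le_trans (IHk (ltnW kn))) // mulrC ler_wpM2l.
Qed.

(** Contrapositive of the triangle inequality. The order on [C] is partial; realness of [r] turns
    the failure of [r <= |alpha i|] into [|alpha i| < r]. *)
Lemma exists_norm_ge_mean (C : numDomainType) n (alpha : 'I_n.+1 -> C) (r : C) :
  r \is Num.real -> n.+1%:R * r <= `|\sum_i alpha i| ->
  exists i, r <= `|alpha i|.
Proof.
move=> rr le_sum; apply/existsP; apply: contraLR le_sum.
rewrite negb_exists => /forallP lt_r.
have rs : n.+1%:R * r \is Num.real by rewrite rpredM ?realn.
rewrite -real_ltNge ?normr_real // (le_lt_trans (ler_norm_sum _ _ _)) //.
have -> : n.+1%:R * r = \sum_(i < n.+1) r.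
  by rewrite sumr_const card_ord mulr_natl.
apply: ltr_sum => [|i _]; last by rewrite real_ltNge ?normr_real.
by apply/hasP; exists ord0; rewrite ?mem_index_enum.
Qed.

(** The threshold [r] separates the roots: one has modulus at least [r], and the lower coefficients,
    being at most [K] times that modulus, keep the others within [1 + 2 K]. *)
Lemma dominant_of_large_subleading (C : numClosedFieldType) (f : {poly C})
    (n : nat) (K r : C) :
  f \is monic -> size f = n.+2 -> 1 <= K -> 1 + 2 * K < r ->
  n.+1%:R * r <= `|f`_n| ->
  (forall k, (k <= n)%N -> `|f`_k| <= K * r) -> dominant f.
Proof.
move=> fm sf K1 Kr fn fK.
have K0 : 0 <= K by rewrite (le_trans ler01).
have r2 : 2 <= r.
  rewrite (le_trans _ (ltW Kr)) // -[2]/(1 + 1) lerD2l.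
  by rewrite (le_trans K1) // mulrDl mul1r lerDl.
have [s] := closed_field_poly_normal f.
rewrite (monicP fm) scale1r => fs.
have ss : size s = n.+1 by move: sf; rewrite fs size_prod_XsubC => -[].
have fnE : f`_n = - \sum_(i < n.+1) s`_i.
  have := coefPn_prod_XsubC (ps := s); rewrite ss -fs /= => -> //.
  by rewrite (big_nth 0) ss big_mkord.
have {}fs : f = \prod_(i < n.+1) ('X - (s`_i)%:P).
  by rewrite [LHS]fs (big_nth 0) ss big_mkord.
have [i0 ri0] : exists i : 'I_n.+1, r <= `|s`_i|.
  apply: exists_norm_ge_mean; last by rewrite -normrN -fnE.
  by rewrite ger0_real // (le_trans _ r2).
rewrite /dominant sf /=; exists (fun i => s`_i); split.
  by rewrite (monicP fm) scale1r.
exists i0 => j ji0; apply: lt_le_trans (ri0); apply: le_lt_trans Kr.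
(* Dropping the index [i0], not the value, leaves any repetition of that root in [g], so the bound
   also excludes a multiple root. *)
pose g := \prod_(i < n.+1 | i != i0) ('X - (s`_i)%:P).
have fg : f = ('X - (s`_i0)%:P) * g by rewrite [LHS]fs (bigD1 i0).
have gm : g \is monic by apply: monic_prod => i _; apply: monicXsubC.
have sg : size g = n.+1.
  by move: sf; rewrite fg size_monicM ?monicXsubC ?monic_neq0 // size_XsubC => -[].
apply: (Cauchy_bound_monic gm sg); first by rewrite mulr_ge0.
  move=> k kn; apply: (@coef_cofactor_XsubC_bound _ _ s`_i0 _ n) => //.
    exact: le_trans r2 ri0.
  by move=> {kn}k kn; rewrite -fg (le_trans (fK _ (ltnW kn))) // ler_wpM2l //.
by rewrite /g (bigD1 j) //= rootM root_XsubC eqxx.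
Qed.

(** * Counting polynomials through coefficient vectors *)

Lemma leq_card_fset_set (T : finType) (U : choiceType) (A : set U)
    (h : T -> U) :
  finite_set A -> injective h -> (forall t, A (h t)) ->
  (#|T| <= #|` fset_set A|)%N.
Proof.
move=> finA injh hA; rewrite -(size_codom h); apply: uniq_leq_size.
  by rewrite map_inj_uniq // enum_uniq.
by move=> _ /codomP[t ->]; rewrite in_fset_set // inE; apply: hA.
Qed.

Lemma geq_card_fset_set (T : finType) (U : choiceType) (A : set U)
    (h : T -> U) :
  finite_set A -> A `<=` range h -> (#|` fset_set A| <= #|T|)%N.
Proof.
move=> finA Ah; rewrite -(size_codom h); apply: uniq_leq_size.
  exact: fset_uniq.
move=> x; rewrite in_fset_set // inE => /Ah[t _ <-]; exact: codom_f.
Qed.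

(** The argument of [a] is the exponent, so the coefficient [a_1] of the English statement is
    [a (n - 1)]. *)
Definition monic_of (R : nzRingType) (n : nat) (a : nat -> R) : {poly R} :=
  'X^n + \poly_(k < n) a k.

Lemma size_monic_of (R : nzRingType) n (a : nat -> R) :
  size (monic_of n a) = n.+1.
Proof. by rewrite size_polyDl size_polyXn // ltnS size_poly. Qed.

Lemma coef_monic_of (R : nzRingType) n (a : nat -> R) k :
  (k < n)%N -> (monic_of n a)`_k = a k.
Proof. by move=> kn; rewrite coefD coefXn coef_poly kn ltn_eqF // add0r. Qed.

Lemma monic_monic_of (R : nzRingType) n (a : nat -> R) :
  monic_of n a \is monic.
Proof.
apply/monicP; rewrite lead_coefE size_monic_of coefD coefXn eqxx.
by rewrite coef_poly ltnn addr0.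
Qed.

Lemma monic_boxP n H (f : {poly int}) :
  monic_box n H f ->
  exists2 a : nat -> int, f = monic_of n a &
    forall k, (k < n)%N -> `|a k| <= H%:Z.
Proof.
move=> [/monicP lf [sf bf]]; exists (fun k => f`_k) => //.
apply/polyP => k; rewrite coefD coefXn coef_poly.
have [->|kn] := eqVneq k n.
  by rewrite ltnn addr0 -[RHS]lf lead_coefE sf.
case: ltnP => nk; first by rewrite add0r.
by rewrite addr0 nth_default // sf ltn_neqAle eq_sym kn.
Qed.

(** * Upper and lower bounds for [D] *)

Lemma D_le (R : realType) n H : (D R n H <= (2 * H).+1 ^ n)%N.
Proof.
have -> : ((2 * H).+1 ^ n)%N = #|{ffun 'I_n -> 'I_(2 * H).+1}|.
  by rewrite card_ffun !card_ord.
(* Coefficients are shifted by [H] into [0..2H]; the default [0] is never read, as [monic_of n] only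
   uses indices below [n]. *)
pose h (g : {ffun 'I_n -> 'I_(2 * H).+1}) : {poly int} :=
  monic_of n (fun k => if insub k is Some i then (g i)%:Z - H%:Z else 0).
apply: (geq_card_fset_set (h := h)); first exact: finite_dominant_monic.
move=> f [/monic_boxP[a -> aH] _].
exists [ffun i : 'I_n => inord (absz (a i + H%:Z))] => //.
congr (_ + _); apply/polyP => k; rewrite !coef_poly.
case: ltnP => // kn; rewrite insubT ffunE /=.
by have := aH _ kn => ak; rewrite inordK; lia.
Qed.

(* For [0 < p <= H], [j] enumerates the integers [c] with
   [H - p < `|c| <= H]. *)
Definition signed_val (H p j : nat) : int :=
  if (j < p)%N then H%:Z - j%:Z else (j - p)%:Z - H%:Z.

Lemma dominant_monic_of (R : realType) m H k (a : nat -> int) :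
  (0 < k)%N -> ((k * m.+1) * (2 * (k * m.+1)).+1 < H)%N ->
  (H%:Z < `|a m| * k%:Z)%R ->
  (forall i, (i < m.+1)%N -> `|a i| <= H%:Z) ->
  dominant_monic R m.+1 H (monic_of m.+1 a).
Proof.
move=> k0 HK am aH; split.
  split; first exact: monic_monic_of.
  by rewrite size_monic_of; split=> // i im; rewrite coef_monic_of // aH.
set f := map_poly _ _.
have fE i : (i < m.+1)%N -> `|f`_i| = `|a i|%:~R.
  by move=> im; rewrite coef_map /= coef_monic_of // intr_norm.
set K := (k * m.+1)%N in HK.
have K0 : (0 < K)%N by rewrite muln_gt0 k0.
have K0' : 0 < K%:R :> R[i] by rewrite ltr0n.
(* With [r = H / K]: [K r = H] bounds the coefficients, [(m+1) r = H / k] lies below [|a m|], and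
   [1 + 2 K < r] is the size condition on [H]. *)
apply: (@dominant_of_large_subleading _ _ m K%:R (H%:R / K%:R)).
- by rewrite monic_map ?monic_monic_of.
- rewrite size_map_poly_id0 ?size_monic_of //.
  by rewrite (monicP (monic_monic_of _ _)) rmorph1 oner_neq0.
- by rewrite ler1n.
- by rewrite ltr_pdivlMr // -natrM -(natrD _ 1) -natrM ltr_nat; lia.
- rewrite fE // mulrA ler_pdivrMr // -natrM -[K%:R]/(K%:Z%:~R) -intrM.
  rewrite -[(m.+1 * H)%:R]/((m.+1 * H)%:Z%:~R) ler_int /K.
  nia.
- move=> i im; rewrite fE // mulrC divfK ?gt_eqF //.
  by rewrite -[H%:R]/(H%:Z%:~R) ler_int aH.
Qed.

Lemma D_ge (R : realType) m H k :
  (0 < k)%N -> ((k * m.+1) * (2 * (k * m.+1)).+1 < H)%N ->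
  ((2 * H) ^ m * (2 * (H - H %/ k)) <= D R m.+1 H)%N.
Proof.
move=> k0 HK; set p := (H - H %/ k)%N.
have pH : (p <= H)%N by apply: leq_subr.
(* Here [H - p = H %/ k], so an integer [c] with [|c| > H - p] satisfies [|c| k > H]. *)
have pk : (H < (H - p).+1 * k)%N.
  by rewrite /p subKn ?leq_div // ltn_ceil.
have -> : ((2 * H) ^ m * (2 * p))%N =
    #|{: {ffun 'I_m -> 'I_(2 * H)} * 'I_(2 * p)}|.
  by rewrite card_prod card_ffun !card_ord.
(* The [m] lower coefficients range over [-H..H-1], omitting [H] so that each has exactly [2H]
   values. *)
pose a (t : {ffun 'I_m -> 'I_(2 * H)} * 'I_(2 * p)) (i : nat) : int :=
  if insub i is Some i' then (t.1 i')%:Z - H%:Z else signed_val H p t.2.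
have am t : a t m = signed_val H p t.2 by rewrite /a insubN // -leqNgt.
apply: (leq_card_fset_set (h := fun t => monic_of m.+1 (a t))).
- exact: finite_dominant_monic.
- move=> [g c] [g' c'] eqh.
  have ea i : (i < m.+1)%N -> a (g, c) i = a (g', c') i.
    move=> im; have := congr1 (fun f : {poly int} => f`_i) eqh.
    by rewrite /= !coef_monic_of.
  congr (_, _).
    apply/ffunP => i; have := ea _ (leqW (ltn_ord i)).
    by rewrite /a !valK /= => /addIr [] /val_inj.
  have := ea _ (ltnSn m); rewrite !am /= /signed_val => ec.
  (* The two branches of [signed_val] take values of opposite sign, and each is injective. *)
  apply: val_inj => /=; have := ltn_ord c; have := ltn_ord c'.
  by move: ec; case: ifP; case: ifP; lia.
- move=> [g c]; have cp := ltn_ord c.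
  have cb : (H - p)%:Z < `|signed_val H p c| /\ `|signed_val H p c| <= H%:Z.
    by rewrite /signed_val; case: ifP; lia.
  apply: (@dominant_monic_of _ _ _ k) => //.
    by rewrite am /=; case: cb; nia.
  move=> i; rewrite ltnS leq_eqVlt => /orP[/eqP->|im].
    by rewrite am; case: cb.
  by rewrite /a insubT /=; move: (g _) => [x /= xH]; clear -xH; lia.
Qed.

(** * Squeezing the normalised count *)

Theorem theorem1p1 (R : realType) (n : nat) (hn : (2 <= n)%N) :
  (D R n H)%:R / (2 * H%:R) ^+ n @[H --> \oo] --> (1 : R).
Proof.
case: n hn => // m _; set n := m.+1.
(* [harmonic H] is [1 / (H+1)], at least [1 / (2H)] once [H >= 1], so this sequence dominates
   [((2H+1) / (2H))^n]. *)
have upper : (1 + harmonic H) ^+ n @[H --> \oo] --> (1 : R).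
  have c1 : x ^+ n @[x --> (1 : R)] --> (1 : R).
    by rewrite -[X in _ --> X](expr1n R n); exact: exprn_continuous.
  apply: cvg_comp c1; have := cvgD (cvg_cst (1 : R)) (@cvg_harmonic R).
  by rewrite addr0; apply.
apply/cvgrPdist_le => e e0.
(* With divisor [k+1], the lower count has ratio [1 - (H %/ (k+1)) / H >= 1 - 1 / (k+1) > 1 - e]. *)
have [k _ /(_ k (leqnn k)) /= ke] := near_infty_natSinv_lt (PosNum e0).
near=> H.
have H1 : (1 <= H)%N by near: H; exact: nbhs_infty_ge.
have H0 : 0 < (2 * H%:R) ^+ n :> R by rewrite exprn_gt0 // mulr_gt0 ?ltr0n.
rewrite ler_distlC; apply/andP; split.
  rewrite ler_pdivlMr //.
  apply: le_trans (_ : ((2 * H) ^ m * (2 * (H - H %/ k.+1)))%:R <= _).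
    rewrite natrM natrX !natrM natrB ?leq_div // exprSr mulrCA.
    rewrite ler_wpM2l ?exprn_ge0 ?mulr_ge0 // mulrCA ler_pM2l ?ltr0n //.
    rewrite mulrBl mul1r lerB // (le_trans (y := k.+1%:R^-1 * H%:R)) //.
      by rewrite ler_pdivlMl // -natrM ler_nat mulnC leq_divM.
    by rewrite ler_wpM2r // ltW.
  rewrite ler_nat D_ge //.
  by near: H; exact: nbhs_infty_gt.
apply: le_trans (_ : (1 + harmonic H) ^+ n <= _); last first.
  by near: H; apply: (cvgr_le _ upper); rewrite ltrDl.
rewrite ler_pdivrMr // -exprMn.
apply: le_trans (_ : (((2 * H).+1 ^ n)%:R : R) <= _).
  by rewrite ler_nat D_le.
rewrite natrX lerXn2r ?nnegrE // ?mulr_ge0 ?addr_ge0 ?invr_ge0 //.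
rewrite -natr1 natrM [leRHS]mulrDl mul1r lerD2l /harmonic /= ler_pdivlMl //.
by rewrite mulr1 -natrM ler_nat; lia.
Unshelve. all: by end_near.
Qed.
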